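(* Let $m\ge 3$, let $P_2=[u_1,u_2]$ be the path of order $2$ and let $C_m=[v_1,\dots,v_m,v_1]$ be the cycle of order $m$. Then the harmonic centrality of any vertex $(u_i,v_j)$ of the direct product $P_2\times C_m$ is $$\mathcal{H}_{P_2\times C_m}(u_i,v_j)=\begin{cases}\dfrac{1}{2m-1}\Big(2H_{m-1}+\dfrac1m\Big) & \text{if } m \text{ is odd},\\[2mm] \dfrac{1}{2m-1}\Big(2H_{\frac{m-2}{2}}+\dfrac2m\Big) & \text{if } m \text{ is even}.\end{cases}$$
   Context: All graphs are simple, undirected and finite. For a graph $G$ of order $n\ge 2$ (number of vertices) and a vertex $u$, the harmonic centrality of $u$ is $\mathcal{H}_G(u)=\frac{\mathcal{R}_G(u)}{n-1}$, where $\mathcal{R}_G(u)=\sum_{x\in V(G),\,x\ne u}\frac{1}{d(u,x)}$, $d$ is the shortest-path distance in $G$, and $\frac{1}{d(u,x)}=0$ if there is no path from $u$ to $x$. $H_n=\sum_{k=1}^n \frac1k$ is the $n$-th harmonic number. The direct product $G\times H$ has vertex set $V(G)\times V(H)$, with $(u,v)$ and $(u',v')$ adjacent iff $u,u'$ are adjacent in $G$ and $v,v'$ are adjacent in $H$. *)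

(* Defs.v *)
From HB Require Import structures.
From mathcomp Require Import all_boot all_order all_algebra.

Set Implicit Arguments.
Unset Strict Implicit.
Unset Printing Implicit Defensive.

Import Order.TTheory GRing.Theory Num.Theory.

Local Open Scope ring_scope.

Record sgraph := SGraph {
  vertex :> finType;
  adj : rel vertex;
  adj_sym : symmetric adj;
  adj_irrefl : irreflexive adj
}.

Section Centrality.

Variable G : sgraph.

(* A path from x to y of length n is x :: p with p of size n and without
   repeated vertices. *)
Definition has_path (x y : G) (n : nat) : bool :=
  [exists p : n.-tuple G,
    [&& path (@adj G) x p, last x p == y & uniq (x :: p)]].

Lemma connect_has_path (x y : G) :
  connect (@adj G) x y -> exists n, has_path x y n.
Proof.
move=> /connectP[p /shortenP[q pq uq _] ->].
exists (size q); apply/existsP; exists (in_tuple q).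
by rewrite /= pq eqxx.
Qed.

(* [None] means that no path joins the two vertices. *)
Definition dist (x y : G) : option nat :=
  if @idP (connect (@adj G) x y) is ReflectT xy
  then Some (ex_minn (connect_has_path xy)) else None.

Definition inv_dist (x y : G) : rat :=
  if dist x y is Some d then d%:R^-1 else 0.

Definition reciprocal_sum (u : G) : rat := \sum_(x : G | x != u) inv_dist u x.

Definition harmonic_centrality (u : G) : rat :=
  reciprocal_sum u / (#|G|%:R - 1).

End Centrality.

Definition harmonic_number (n : nat) : rat := \sum_(1 <= k < n.+1) k%:R^-1.

Section DirectProduct.

Variables G H : sgraph.

Definition direct_adj : rel (G * H) :=
  fun x y => adj x.1 y.1 && adj x.2 y.2.

Lemma direct_adj_sym : symmetric direct_adj.
Proof. by move=> x y; rewrite /direct_adj adj_sym [adj x.2 _]adj_sym. Qed.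

Lemma direct_adj_irrefl : irreflexive direct_adj.
Proof. by move=> x; rewrite /direct_adj adj_irrefl. Qed.

Definition direct_product : sgraph := SGraph direct_adj_sym direct_adj_irrefl.

End DirectProduct.

(* Vertices are numbered from 0. *)
Definition path_adj (n : nat) : rel 'I_n :=
  fun i j => (j == i.+1 :> nat) || (i == j.+1 :> nat).

Lemma path_adj_sym n : symmetric (@path_adj n).
Proof. by move=> i j; rewrite /path_adj orbC. Qed.

Lemma path_adj_irrefl n : irreflexive (@path_adj n).
Proof. by move=> i; rewrite /path_adj orbb ltn_eqF. Qed.

Definition path_graph (n : nat) : sgraph :=
  SGraph (@path_adj_sym n) (@path_adj_irrefl n).

Definition cycle_adj (m : nat) : rel 'I_m :=
  fun i j => (j == i.+1 %% m :> nat)%N || (i == j.+1 %% m :> nat)%N.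

Lemma cycle_adj_sym m : symmetric (@cycle_adj m).
Proof. by move=> i j; rewrite /cycle_adj orbC. Qed.

Lemma cycle_adj_irrefl m : (3 <= m)%N -> irreflexive (@cycle_adj m).
Proof.
move=> m_ge3 i; rewrite /cycle_adj orbb.
have := ltn_ord i; rewrite leq_eqVlt => /orP[/eqP im|im].
  by rewrite im modnn; case: (nat_of_ord i) im m_ge3 => // <-.
by rewrite modn_small // ltn_eqF.
Qed.

Definition cycle_graph (m : nat) (m_ge3 : (3 <= m)%N) : sgraph :=
  SGraph (@cycle_adj_sym m) (cycle_adj_irrefl m_ge3).

(* Main.v *)
(** The component of (u_i, v_j) in P_2 x C_m is traced out by n |-> (i + n mod 2,
    j + n mod m), which is injective exactly modulo lcm(2, m).  So the component
    is a cycle of even length 2h, with h = m for odd m and h = m/2 for even m;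
    vertices outside it contribute 0, and the k-th vertex of a cycle of length 2h
    lies at distance min(k, 2h - k) from the start. *)
Require Import Defs.
From mathcomp Require Import all_boot all_order all_algebra.
From mathcomp Require Import zify ring.

Import GRing.Theory Num.Theory.
Local Open Scope ring_scope.

(** Every walk shortens to a repetition-free path with no more edges, so a walk that is shortest
    among walks attains the minimum over paths used in [dist]. *)
Lemma dist_shortest_walk (G : sgraph) (x : G) (p : seq G) :
    path (@adj G) x p ->
    (forall q, path (@adj G) x q -> last x q = last x p ->
       (size p <= size q)%N) ->
  dist x (last x p) = Some (size p).
Proof.
move=> xp p_min; rewrite /dist.
case: {-}_ / idP => [xy|[]]; last first.
  by apply/connectP; exists p.
congr Some; case: ex_minnP => n /existsP[q /and3P[xq /eqP lq _]] n_min.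
apply/eqP; rewrite eqn_leq -{2}(size_tuple q) p_min // andbT.
case: (shortenP xp) n_min => r xr r_uniq r_sub n_min.
apply: leq_trans (uniq_leq_size (proj2 (andP r_uniq)) r_sub).
by apply: n_min; apply/existsP; exists (in_tuple r); rewrite /= xr eqxx.
Qed.

Lemma inv_dist_disconnected (G : sgraph) (x y : G) :
  ~~ connect (@adj G) x y -> inv_dist x y = 0.
Proof.
move=> /negP xy; rewrite /inv_dist /dist.
by case: {-}_ / idP.
Qed.

Section CyclicComponent.

Variables (G : sgraph) (L : nat) (f : nat -> G).
Hypothesis L_gt0 : (0 < L)%N.
Hypothesis f_eq : forall a b, (f a == f b) = (a == b %[mod L]).
(** [a + L.-1] encodes a - 1 modulo [L], avoiding truncated subtraction at a = 0. *)
Hypothesis f_adj :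
  forall a y, adj (f a) y = (y == f a.+1) || (y == f (a + L.-1)%N).

(* [b] and [c] count the steps forward and backward. *)
Lemma cyclic_walk_end a p :
  path (@adj G) (f a) p ->
  exists b c, (b + c = size p)%N /\ last (f a) p = f (a + b + c * L.-1)%N.
Proof.
elim: p a => [|y p IHp] a /=; first by exists 0%N, 0%N; rewrite mul0n !addn0.
rewrite f_adj => /andP[/orP[]/eqP-> /IHp[b [c [<- ->]]]].
  by exists b.+1, c; split; last congr f; lia.
by exists b, c.+1; split; last congr f; lia.
Qed.

Lemma cyclic_walk_forward a n :
  exists p, [/\ path (@adj G) (f a) p, last (f a) p = f (a + n)%N
                & size p = n].
Proof.
elim: n a => [|n IHn] a; first by exists [::]; rewrite addn0; split.
have [p [fp lp sp]] := IHn a.+1.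
by exists (f a.+1 :: p); rewrite /= f_adj eqxx lp addSnnS sp.
Qed.

Lemma cyclic_walk_backward a n :
  exists p, [/\ path (@adj G) (f (a + n)%N) p, last (f (a + n)%N) p = f a
                & size p = n].
Proof.
elim: n => [|n [p [fp lp sp]]]; first by exists [::]; rewrite addn0; split.
exists (f (a + n)%N :: p).
by rewrite /= adj_sym f_adj addnS eqxx fp sp.
Qed.

Lemma cyclic_walk_size k p :
    (k < L)%N -> path (@adj G) (f 0) p -> last (f 0) p = f k ->
  (minn k (L - k) <= size p)%N.
Proof.
move=> k_lt /cyclic_walk_end[b [c [<- ->]]] /eqP; rewrite f_eq add0n => bc_k.
(* Adding c turns c(L - 1) into a multiple of L. If k <= b, the forward steps alone suffice;
   otherwise L divides k + c - b > 0, which forces c >= L - k. *)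
have : k + c == b %[mod L].
  rewrite -modnDml -(eqP bc_k) modnDml -addnA -mulnSr prednK //.
  by rewrite addnC modnMDl.
case: (leqP k b) => [kb _|bk]; first by lia.
rewrite eqn_mod_dvd; last by lia.
move/dvdn_leq; lia.
Qed.

Lemma cyclic_inv_dist k :
  (0 < k < L)%N -> inv_dist (f 0) (f k) = (minn k (L - k))%:R^-1.
Proof.
case/andP=> k_gt0 k_lt.
suff [p [fp lp sp]] : exists p, [/\ path (@adj G) (f 0) p,
    last (f 0) p = f k & size p = minn k (L - k)].
  rewrite /inv_dist -lp dist_shortest_walk ?sp // => q fq lq.
  by apply: cyclic_walk_size => //; rewrite lq.
have [kL|Lk] := leqP k (L - k); first exact: cyclic_walk_forward.
(* Going backward is shorter here: reading [f 0] as [f L], L - k backward steps lead to [f k]. *)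
have -> : f 0 = f (k + (L - k))%N.
  by apply/eqP; rewrite f_eq subnKC ?(ltnW k_lt) // modnn mod0n.
exact: cyclic_walk_backward.
Qed.

Lemma cyclic_reciprocal_sum :
  reciprocal_sum (f 0) = \sum_(1 <= k < L) (minn k (L - k))%:R^-1.
Proof.
(* [s] lists the component of [f 0] without [f 0] itself. *)
pose s := [seq f k | k <- index_iota 1 L].
have s_uniq : uniq s.
  rewrite map_inj_in_uniq ?iota_uniq // => a b.
  rewrite !mem_index_iota => /andP[_ aL] /andP[_ bL] /eqP.
  by rewrite f_eq !modn_small // => /eqP.
have f0_s : f 0 \notin s.
  apply/mapP => -[k]; rewrite mem_index_iota => /andP[k_gt0 kL] /eqP.
  by rewrite f_eq mod0n modn_small // ltn_eqF.
have -> : reciprocal_sum (f 0) = \sum_(x in s) inv_dist (f 0) x.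
  rewrite /reciprocal_sum big_mkcond [RHS]big_mkcond /=.
  apply: eq_bigr => x _.
  have [->|x_f0] := eqVneq x; first by rewrite (negbTE f0_s).
  case: ifPn => // x_s; apply: inv_dist_disconnected; apply: contra x_s.
  case/connectP=> p /cyclic_walk_end[b [c [_ ->]]] x_def; move: x_f0.
  rewrite {}x_def; set n := (0 + b + _)%N.
  rewrite f_eq mod0n => n_gt0; apply/mapP; exists (n %% L)%N.
    by rewrite mem_index_iota ltn_mod L_gt0 andbT lt0n.
  by apply/eqP; rewrite f_eq modn_mod.
rewrite -big_uniq //= big_map big_nat_cond [RHS]big_nat_cond.
by apply: eq_bigr => k /andP[k_range _]; apply: cyclic_inv_dist.
Qed.

End CyclicComponent.

(** The terms at k and 2h - k agree, so each half gives a harmonic number; the midpoint k = h gives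
    1/h. *)
Lemma sum_inv_cycle_dist (h : nat) :
    (0 < h)%N ->
  \sum_(1 <= k < h.*2) ((minn k (h.*2 - k))%:R^-1 : rat) =
  2 * harmonic_number h.-1 + h%:R^-1.
Proof.
case: h => // h _; rewrite /harmonic_number /=.
rewrite (big_cat_nat (n := h.+2)) /=; [|lia|lia].
have -> : \sum_(1 <= k < h.+2) ((minn k (h.+1.*2 - k))%:R^-1 : rat) =
    \sum_(1 <= k < h.+1) k%:R^-1 + h.+1%:R^-1.
  rewrite -big_nat_recr //=; apply: eq_big_nat => k k_range.
  by congr (_%:R^-1); lia.
suff -> : \sum_(h.+2 <= k < h.+1.*2) ((minn k (h.+1.*2 - k))%:R^-1 : rat) =
    \sum_(1 <= k < h.+1) k%:R^-1 by ring.
(* After reversal and shift, the index k stands for the former 2(h + 1) - k. *)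
rewrite big_nat_rev (_ : h.+2 = 1 + h.+1)%N // big_addn.
rewrite (_ : (h.+1.*2 - h.+1)%N = h.+1); last by lia.
apply: eq_big_nat => k k_range; congr (_%:R^-1); lia.
Qed.

Section DirectProductComponent.

Local Open Scope nat_scope.

Variables (m : nat) (m_ge3 : (3 <= m)).
Variables (i : path_graph 2) (j : cycle_graph m_ge3).

Let m_gt0 : (0 < m) := ltnW (ltnW m_ge3).

(** The vertices of P_2 are treated as residues modulo 2, so that one step adds 1 in both
    coordinates. *)
Definition diagonal_walk (n : nat) :
    direct_product (path_graph 2) (cycle_graph m_ge3) :=
  (Ordinal (ltn_pmod (i + n) (ltn0Sn 1)), Ordinal (ltn_pmod (j + n) m_gt0)).

Lemma diagonal_walk0 : diagonal_walk 0 = (i, j).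
Proof. by congr pair; apply: val_inj; rewrite /= addn0 modn_small. Qed.

Lemma diagonal_walk_eq a b :
  (diagonal_walk a == diagonal_walk b) = (a == b %[mod lcmn 2 m]).
Proof.
rewrite xpair_eqE -!val_eqE /= !eqn_modDl.
wlog ab : a b / (b <= a).
  move=> H; case: (leqP b a) => [|/ltnW] /H //.
  by rewrite ![(b %% _) == _]eq_sym.
by rewrite !eqn_mod_dvd // dvdn_lcm.
Qed.

(** A neighbour shifts the second coordinate by 1 or -1 and flips the first; modulo 2 both shifts
    are the flip, so both signs stay on the walk. *)
Lemma diagonal_walk_adj a y :
  adj (diagonal_walk a) y =
  (y == diagonal_walk a.+1) || (y == diagonal_walk (a + (lcmn 2 m).-1)).
Proof.
have L_gt0 : (0 < lcmn 2 m) by rewrite lcmn_gt0.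
have := dvdn_lcml 2 m; have := dvdn_lcmr 2 m.
(* Only L > 0 and L = 0 modulo 2 and m are kept: they make adding L - 1 a step back in each
   factor. *)
move: (lcmn 2 m) L_gt0 => L L_gt0 m_dvd_L even_L.
case: y => y1 y2; rewrite !xpair_eqE -!val_eqE /= /direct_adj /= /path_adj.
rewrite /cycle_adj /= !addnS.
have -> : ((i + (a + L.-1)) %% 2 = (i + a).+1 %% 2).
  apply/eqP; rewrite -(eqn_modDr 1) !addn1 addnA -addnS prednK //.
  have /dvdnP[q ->] := even_L; rewrite addnC modnMDl -(addn2 (i + a)).
  by rewrite modnDr.
have -> : ((j + a) %% m).+1 = (j + a).+1 %[mod m].
  by rewrite -addn1 modnDml addn1.
have -> : (val y2 == (j + (a + L.-1)) %% m) = (j + a == y2.+1 %[mod m]).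
  rewrite -[val y2 in LHS](modn_small (ltn_ord y2)) -(eqn_modDr 1) eq_sym !addn1.
  rewrite addnA -addnS prednK // addnC.
  by have /dvdnP[q ->] := m_dvd_L; rewrite modnMDl.
rewrite -andb_orr; congr (_ && _).
(* Adjacency in P_2 is now checked on the residues 0 and 1. *)
rewrite -(addn1 (i + a)) -(modnDml (i + a)); have := ltn_pmod (i + a) (ltn0Sn 1).
by case: ((i + a) %% 2) => [|[|?]] //; case: y1 => -[|[|?]].
Qed.

End DirectProductComponent.

Theorem theorem3p8 (m : nat) (m_ge3 : (3 <= m)%N)
    (i : path_graph 2) (j : cycle_graph m_ge3) :
  @harmonic_centrality (direct_product (path_graph 2) (cycle_graph m_ge3))
    (i, j) =
  if odd m
  then 1 / (2 * m%:R - 1) * (2 * harmonic_number (m - 1) + 1 / m%:R)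
  else 1 / (2 * m%:R - 1) * (2 * harmonic_number ((m - 2) %/ 2) + 2 / m%:R).
Proof.
have m_gt0 : (0 < m)%N by lia.
rewrite /harmonic_centrality card_prod !card_ord natrM mulrC.
rewrite -(diagonal_walk0 m m_ge3).
rewrite (cyclic_reciprocal_sum _ (lcmn 2 m)); first last.
- exact: diagonal_walk_adj.
- exact: diagonal_walk_eq.
- by rewrite lcmn_gt0.
have [m_odd|m_even] := boolP (odd m).
  have -> : lcmn 2 m = m.*2.
    have /eqP co2m : coprime 2 m by rewrite coprime2n.
    by rewrite -mul2n -muln_lcm_gcd co2m muln1.
  by rewrite sum_inv_cycle_dist // subn1 !div1r.
(* For even m the component has length m = 2h, so h - 1 = (m - 2)/2 and 1/h = 2/m. *)
have m_half : m = m./2.*2 by rewrite -[LHS]odd_double_half (negbTE m_even).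
have -> : lcmn 2 m = m./2.*2.
  by apply/eqP; rewrite -m_half eqn_dvd dvdn_lcmr dvdn_lcm dvdnn dvdn2 m_even.
rewrite sum_inv_cycle_dist ?div1r; last by lia.
congr (_ * (2 * harmonic_number _ + _)); first by lia.
by rewrite [in RHS]m_half -mul2n natrM invfM mulrA divff ?mul1r.
Qed.
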